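(* Let $m,p$ be positive integers with $p\geq m+1$, and let $n\in\mathbb{R}$. Then for all real $x$ with $0<|x|<1$, $${}_2F_1(m,n;p;x)=\frac{(m)_{p-m}\,x^{1-p}}{(p-m-1)!}\sum_{k=0}^{m-1}(-1)^k\binom{m-1}{k}\sum_{j=0}^{p-m-1}\binom{p-m-1}{j}(-1)^j x^{p-m-1-j}\sum_{i=0}^{j}\binom{j}{i}(-1)^i\int_{1-x}^{1}s^{i+k-n}\,ds.$$ Consequently, $x\mapsto{}_2F_1(m,n;p;x)$ is an elementary function.
   Context: $(r)_0:=1$ and $(r)_j:=r(r+1)\cdots(r+j-1)$ for $j\ge 1$. The hypergeometric function is ${}_2F_1(a,b;c;x)=\sum_{j=0}^\infty \frac{(a)_j(b)_j}{(c)_j\,j!}x^j$ for $|x|<1$ ($c$ not zero or a negative integer). ''Elementary function'' means: for $0<|x|<1$ it is given by a finite expression built from constants and the variable $x$ by arithmetic operations, compositions, real powers, exponentials and logarithms. *)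

(* Defs.v *)
From Stdlib Require Import Reals Lra Lia Factorial.
From Coquelicot Require Import Coquelicot.
Open Scope R_scope.

Fixpoint poch (r : R) (j : nat) : R :=
  match j with
  | O => 1
  | S j' => poch r j' * (r + INR j')
  end.

Definition hyp2F1_coeff (a b c : R) (j : nat) : R :=
  (poch a j * poch b j) / (poch c j * INR (fact j)).

(* Meant for [Rabs x < 1] and [c] not zero or a negative integer; the series
   then converges by [ex_pseries_hyp2F1] below. *)
Definition hyp2F1 (a b c x : R) : R := PSeries (hyp2F1_coeff a b c) x.

Inductive expr : Type :=
  | EVar : expr
  | EConst : R -> expr
  | EAdd : expr -> expr -> expr
  | ESub : expr -> expr -> expr
  | EMul : expr -> expr -> expr
  | EDiv : expr -> expr -> expr
  | EComp : expr -> expr -> expr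
  | EPow : expr -> R -> expr
  | EExp : expr -> expr
  | ELn : expr -> expr.

Fixpoint eval (e : expr) (x : R) : R :=
  match e with
  | EVar => x
  | EConst r => r
  | EAdd e1 e2 => eval e1 x + eval e2 x
  | ESub e1 e2 => eval e1 x - eval e2 x
  | EMul e1 e2 => eval e1 x * eval e2 x
  | EDiv e1 e2 => eval e1 x / eval e2 x
  | EComp e1 e2 => eval e1 (eval e2 x)
  | EPow e1 r => Rpower (eval e1 x) r
  | EExp e1 => exp (eval e1 x)
  | ELn e1 => ln (eval e1 x)
  end.

(* [Rdiv], [Rpower] and [ln] are total, so [eval] is only meaningful where no
   division by zero occurs and every argument of a logarithm or base of a real
   power is positive. *)
Fixpoint defined (e : expr) (x : R) : Prop :=
  match e with
  | EVar | EConst _ => True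
  | EAdd e1 e2 | ESub e1 e2 | EMul e1 e2 => defined e1 x /\ defined e2 x
  | EDiv e1 e2 => defined e1 x /\ defined e2 x /\ eval e2 x <> 0
  | EComp e1 e2 => defined e2 x /\ defined e1 (eval e2 x)
  | EExp e1 => defined e1 x
  | EPow e1 _ | ELn e1 => defined e1 x /\ 0 < eval e1 x
  end.

Definition elementary (f : R -> R) : Prop :=
  exists e : expr,
    forall x : R, 0 < Rabs x < 1 -> defined e x /\ f x = eval e x.

Lemma poch_neq0 (r : R) (j : nat) :
  (forall k : nat, r <> - INR k) -> poch r j <> 0.
Proof.
intros H; induction j as [|j IH]; simpl; [lra|].
apply Rmult_integral_contrapositive_currified; [exact IH|].
intros E; apply (H j); lra.
Qed.

Lemma poch_eq0_add (r : R) (N k : nat) : poch r N = 0 -> poch r (N + k) = 0.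
Proof.
intros H; induction k as [|k IH].
- now rewrite Nat.add_0_r.
- rewrite Nat.add_succ_r; simpl; rewrite IH; ring.
Qed.

Lemma is_lim_seq_shift_ratio (u v : R) : (forall k : nat, v <> - INR k) ->
  is_lim_seq (fun k : nat => (u + INR k) / (v + INR k)) 1.
Proof.
intros Hv.
assert (Hv' : forall k, v + INR k <> 0) by (intros k E; apply (Hv k); lra).
apply is_lim_seq_ext with (fun k : nat => 1 + (u - v) * / (v + INR k)).
{ intros k; field; apply Hv'. }
replace (Finite 1) with (Finite (1 + (u - v) * 0)) by (f_equal; ring).
apply is_lim_seq_plus'; [apply is_lim_seq_const|].
apply is_lim_seq_mult'; [apply is_lim_seq_const|].
apply (is_lim_seq_inv (fun k : nat => v + INR k) p_infty); [|discriminate].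
apply is_lim_seq_plus with v p_infty;
  [apply is_lim_seq_const | apply is_lim_seq_INR | reflexivity].
Qed.

Lemma ex_pseries_hyp2F1 (a b c x : R) :
  (forall k : nat, c <> - INR k) -> Rabs x < 1 ->
  ex_pseries (hyp2F1_coeff a b c) x.
Proof.
intros Hc Hx.
destruct (Classical_Prop.classic (exists N, poch a N * poch b N = 0))
  as [[N HN]|Hnz].
- apply ex_pseries_R.
  apply (ex_series_incr_n (fun n => hyp2F1_coeff a b c n * x ^ n) N).
  apply ex_series_ext with (fun _ : nat => 0).
  + intros k; unfold hyp2F1_coeff.
    match goal with |- ?l = ?r => change (@eq R l r) end.
    destruct (Rmult_integral _ _ HN) as [E|E];
      rewrite (poch_eq0_add _ N k E); unfold Rdiv; ring.
  + exists 0; change (is_lim_seq (sum_n (fun _ : nat => 0)) 0).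
    apply (is_lim_seq_ext (fun _ => 0)).
    * intros n; rewrite sum_n_const; ring.
    * apply is_lim_seq_const.
- assert (Hab : forall j, poch a j * poch b j <> 0)
    by (intros j E; apply Hnz; exists j; exact E).
  assert (Hpc : forall j, poch c j <> 0)
    by (intros j; apply poch_neq0; exact Hc).
  assert (Hf : forall j, INR (fact j) <> 0) by (intros j; apply INR_fact_neq_0).
  apply CV_radius_inside.
  assert (E : CV_radius (hyp2F1_coeff a b c) = Finite (/ 1)).
  2: { rewrite E, Rinv_1; exact Hx. }
  apply CV_radius_finite_DAlembert; [|lra|].
  + intros j; unfold hyp2F1_coeff, Rdiv.
    apply Rmult_integral_contrapositive_currified; [apply Hab|].
    apply Rinv_neq_0_compat.
    apply Rmult_integral_contrapositive_currified; auto.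
  + apply is_lim_seq_ext with (fun j : nat =>
      Rabs ((a + INR j) / (c + INR j) * ((b + INR j) / (1 + INR j)))).
    * intros j; f_equal; unfold hyp2F1_coeff.
      assert (Ha : poch a j <> 0) by (intros E; apply (Hab j); rewrite E; ring).
      assert (Hb : poch b j <> 0) by (intros E; apply (Hab j); rewrite E; ring).
      rewrite fact_simpl, mult_INR, S_INR; simpl.
      generalize (pos_INR j); intros Hj.
      field; repeat split; auto; try lra.
      intros E; apply (Hc j); lra.
    * replace (Finite 1) with (Rbar_abs (Finite (1 * 1)))
        by (simpl; f_equal; rewrite Rmult_1_r; apply Rabs_R1).
      apply is_lim_seq_abs, is_lim_seq_mult'; apply is_lim_seq_shift_ratio;
        [exact Hc|].
      intros k; generalize (pos_INR k); lra.
Qed.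

(* Main.v *)
(* Up to a constant, the hypergeometric series multiplied by x^(p-1) is the
   (p-m)-fold antiderivative from 0 of u^(m-1) (1-u)^(-n): integrating
   the binomial series term by term produces the coefficients (m)_j / (p)_j.
   Writing the iterated antiderivative as one integral against
   (x-u)^(p-m-1) gives Euler's integral; with s = 1-u and binomial
   expansions of (x-(1-s))^(p-m-1) and of the powers of 1-s it becomes the
   triple sum.  Each remaining integral of a power of s is a power or a
   logarithm of 1-x. *)
Require Import Defs.
From Stdlib Require Import Reals Lra Lia Factorial.
From Coquelicot Require Import Coquelicot.
Open Scope R_scope.

(* [ring] and [field] do not recognise Coquelicot's carrier projections as [R]. *)
Ltac eq_in_R := match goal with |- ?l = ?r => change (@eq R l r) end.

(** * Repeated termwise integration of power series *)

Definition PS_Int_n (k : nat) (a : nat -> R) : nat -> R := Nat.iter k PS_Int a.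

Lemma Rbar_lt_Rabs_between (x u : R) (r : Rbar) :
  Rbar_lt (Rabs x) r -> Rmin 0 x <= u <= Rmax 0 x -> Rbar_lt (Rabs u) r.
Proof.
intros Hx Hu; apply Rbar_le_lt_trans with (2 := Hx); simpl.
revert Hu; unfold Rmin, Rmax, Rabs.
destruct (Rle_dec 0 x), (Rcase_abs u), (Rcase_abs x); lra.
Qed.

Lemma is_derive_PSeries_Int (a : nat -> R) (x : R) :
  Rbar_lt (Rabs x) (CV_radius a) ->
  is_derive (PSeries (PS_Int a)) x (PSeries a x).
Proof.
intros Hx.
rewrite (PSeries_ext a (PS_derive (PS_Int a))).
- apply is_derive_PSeries; rewrite CV_radius_Int; exact Hx.
- intros j; unfold PS_derive, PS_Int; field; apply not_0_INR; lia.
Qed.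

Lemma continuous_PSeries (a : nat -> R) (x : R) :
  Rbar_lt (Rabs x) (CV_radius a) -> continuous (PSeries a) x.
Proof.
intros Hx; apply (ex_derive_continuous (V := R_NormedModule)).
eexists; apply is_derive_PSeries; exact Hx.
Qed.

(* Cauchy's formula for repeated integration; the induction step is an
   integration by parts, whose boundary terms vanish. *)
Lemma is_RInt_repeated_PSeries (q : nat) (a : nat -> R) (x : R) :
  Rbar_lt (Rabs x) (CV_radius a) ->
  is_RInt (fun u => (x - u) ^ q * PSeries a u) 0 x
    (INR (fact q) * PSeries (PS_Int_n (S q) a) x).
Proof.
revert a; induction q as [|q IH]; intros a Hx.
- simpl; rewrite Rmult_1_l.
  apply is_RInt_ext with (PSeries a); [intros; eq_in_R; ring|].
  apply is_RInt_PSeries; exact Hx.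
- assert (Hu : forall u, Rmin 0 x <= u <= Rmax 0 x ->
    Rbar_lt (Rabs u) (CV_radius a))
    by (intros u; apply Rbar_lt_Rabs_between, Hx).
  assert (Hx' : Rbar_lt (Rabs x) (CV_radius (PS_Int a)))
    by (rewrite CV_radius_Int; exact Hx).
  specialize (IH _ Hx').
  apply (is_RInt_scal _ _ _ (- INR (S q))) in IH.
  match type of IH with is_RInt _ _ _ ?l =>
    assert (IBP := is_RInt_scal_derive_r (V := R_CompleteNormedModule)
      (fun u => (x - u) ^ S q) (PSeries (PS_Int a))
      (fun u => - INR (S q) * (x - u) ^ q) (PSeries a) 0 x l)
  end.
  (* The claimed value is written as the outcome of the integration by parts. The boundary term at
     [x] has the factor [(x - x) ^ S q], and the one at 0 vanishes because [PS_Int a] has constant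
     coefficient 0. *)
  replace (INR (fact (S q)) * PSeries (PS_Int_n (S (S q)) a) x) with
    (minus (minus (scal ((x - x) ^ S q) (PSeries (PS_Int a) x))
       (scal ((x - 0) ^ S q) (PSeries (PS_Int a) 0)))
       (scal (- INR (S q))
          (INR (fact q) * PSeries (PS_Int_n (S q) (PS_Int a)) x))).
  2: { unfold PS_Int_n; rewrite <- Nat.iter_succ_r, PSeries_0.
       rewrite fact_simpl, mult_INR.
       unfold minus, plus, opp, scal, mult, PS_Int at 2; cbn -[INR].
       unfold mult; cbn -[INR]; ring. }
  apply IBP.
  + intros u _; auto_derive; [exact I|].
    change (- (1) * (INR (S q) * (x - u) ^ q) = - INR (S q) * (x - u) ^ q).
    ring.
  + intros u Hu'; apply is_derive_PSeries_Int, Hu, Hu'.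
  + intros u _; apply (ex_derive_continuous (V := R_NormedModule)).
    auto_derive; exact I.
  + intros u Hu'; apply continuous_PSeries, Hu, Hu'.
  + revert IH; apply is_RInt_ext.
    intros u _; unfold scal; simpl; unfold mult; simpl; ring.
Qed.

Lemma PS_Int_n_lt (k : nat) (a : nat -> R) (j : nat) :
  (j < k)%nat -> PS_Int_n k a j = 0.
Proof.
revert j; induction k as [|k IH]; intros [|j] Hj; try lia; [reflexivity|].
change (PS_Int_n k a j / INR (S j) = 0); rewrite IH by lia.
unfold Rdiv; ring.
Qed.

(** Each integration divides a coefficient by its new exponent, so [k] of them divide by
    [(j+1)...(j+k)]. *)
Lemma PS_Int_n_plus (k : nat) (a : nat -> R) (j : nat) :
  PS_Int_n k a (k + j) = a j * INR (fact j) / INR (fact (k + j)).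
Proof.
induction k as [|k IH].
- simpl; field; apply INR_fact_neq_0.
- change (PS_Int_n k a (k + j) / INR (S (k + j)) =
    a j * INR (fact j) / INR (fact (S (k + j)))).
  rewrite IH, fact_simpl, mult_INR; field.
  split; [apply INR_fact_neq_0 | apply not_0_INR; lia].
Qed.

(** * The binomial series of [(1 - x)^(-n)] *)

Definition binom_series (n : R) (j : nat) : R := poch n j / INR (fact j).

Lemma poch_neq_0_pos (r : R) (j : nat) : 0 < r -> poch r j <> 0.
Proof.
intros Hr; apply poch_neq0; intros k E.
generalize (pos_INR k); lra.
Qed.

(** The series is that of [hyp2F1 n 1 1], hence converges at [y], the midpoint of [Rabs x] and 1. A
    radius below [y] would keep its terms there from tending to 0. *)
Lemma CV_radius_binom_series (n x : R) :
  Rabs x < 1 -> Rbar_lt (Rabs x) (CV_radius (binom_series n)).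
Proof.
intros Hx.
set (y := (Rabs x + 1) / 2).
assert (Hxy : Rabs x < y) by (unfold y; lra).
assert (Hy : Rabs y = y)
  by (apply Rabs_pos_eq; generalize (Rabs_pos x); unfold y; lra).
apply Rbar_lt_le_trans with y; [exact Hxy|].
apply Rbar_not_lt_le; rewrite <- Hy at 1; intros H.
apply CV_disk_outside in H; apply H.
apply ex_series_lim_0.
apply ex_series_ext with (fun j => hyp2F1_coeff n 1 1 j * y ^ j).
- intros j; unfold hyp2F1_coeff, binom_series.
  eq_in_R.
  field; split; [apply INR_fact_neq_0 | apply poch_neq_0_pos; lra].
- apply ex_pseries_R, ex_pseries_hyp2F1; [|rewrite Hy; unfold y; lra].
  intros k; generalize (pos_INR k); lra.
Qed.

(** The coefficients [c_j] satisfy [(j+1) c_{j+1} = (n+j) c_j], which is [f' = n f + x f'] read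
    coefficientwise. *)
Lemma binom_series_ode (n x : R) : Rabs x < 1 ->
  (1 - x) * PSeries (PS_derive (binom_series n)) x =
  n * PSeries (binom_series n) x.
Proof.
intros Hx; assert (Hr := CV_radius_binom_series n x Hx).
assert (E : PSeries (PS_derive (binom_series n)) x =
  n * PSeries (binom_series n) x + x * PSeries (PS_derive (binom_series n)) x).
2: { rewrite Rmult_minus_distr_r, Rmult_1_l; rewrite E at 1; ring. }
rewrite <- PSeries_scal, <- PSeries_incr_1, <- PSeries_plus.
- apply PSeries_ext; intros j.
  unfold PS_plus, PS_scal, PS_derive, binom_series.
  rewrite fact_simpl, mult_INR; cbn [poch].
  assert (HS : INR (S j) <> 0) by (apply not_0_INR; lia).
  assert (Hf := INR_fact_neq_0 j).
  destruct j as [|j]; unfold PS_incr_1.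
  + cbn; unfold scal, mult, plus, zero; cbn; unfold mult; cbn; field.
  + unfold scal, plus; cbn -[INR poch fact]; unfold mult; cbn -[INR poch fact].
    change (poch n j * (n + INR j)) with (poch n (S j)).
    field; auto.
- apply ex_pseries_scal; [apply Rmult_comm | apply CV_radius_inside, Hr].
- apply ex_pseries_incr_1, ex_pseries_derive, Hr.
Qed.

(** By the differential equation, the series times [(1 - u)^n] has zero derivative on the unit
    interval around 0; its value at 0 is 1. *)
Lemma PSeries_binom_series (n x : R) : Rabs x < 1 ->
  PSeries (binom_series n) x = Rpower (1 - x) (- n).
Proof.
intros Hx.
set (h := fun u => PSeries (binom_series n) u * Rpower (1 - u) n).
assert (Hd : forall u, Rabs u < 1 -> is_derive h u 0).
{ intros u Hu.
  assert (Hu1 : 0 < 1 - u) by (apply Rabs_def2 in Hu; lra).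
  replace 0 with (PSeries (PS_derive (binom_series n)) u * Rpower (1 - u) n +
    PSeries (binom_series n) u * (- (n * Rpower (1 - u) (n - 1)))).
  2: { assert (Ode := binom_series_ode n u Hu).
       (* Splitting off one factor [1 - u] makes the difference of the two sides of the differential
          equation appear. *)
       replace n with (1 + (n - 1)) at 2 by ring.
       rewrite Rpower_plus, Rpower_1 by exact Hu1.
       transitivity (Rpower (1 - u) (n - 1) *
         ((1 - u) * PSeries (PS_derive (binom_series n)) u -
          n * PSeries (binom_series n) u)); [ring|].
       rewrite Ode; ring. }
  apply (is_derive_mult (PSeries (binom_series n)) (fun u => Rpower (1 - u) n)).
  - apply is_derive_PSeries, CV_radius_binom_series, Hu.
  - replace (- (n * Rpower (1 - u) (n - 1))) with
      (scal (-1) (n * Rpower (1 - u) (n - 1)))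
      by (unfold scal; simpl; unfold mult; simpl; ring).
    apply (is_derive_comp (fun v => Rpower v n) (fun u => 1 - u)).
    + apply is_derive_Reals, derivable_pt_lim_power, Hu1.
    + auto_derive; [exact I | ring].
  - intros; apply Rmult_comm. }
assert (Hh : h x = h 0).
{ destruct (MVT_gen h 0 x (fun _ => 0)) as [c [_ Hc]].
  - intros u Hu; apply Hd, (Rbar_lt_Rabs_between x u 1 Hx); lra.
  - intros u Hu; apply continuity_pt_filterlim.
    apply (ex_derive_continuous (V := R_NormedModule)).
    exists 0; apply Hd, (Rbar_lt_Rabs_between x u 1 Hx); lra.
  - lra. }
unfold h in Hh; rewrite PSeries_0 in Hh; unfold binom_series in Hh at 2.
simpl in Hh; rewrite Rminus_0_r in Hh; unfold Rpower at 2 in Hh.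
rewrite ln_1, Rmult_0_r, exp_0 in Hh.
rewrite Rpower_Ropp.
apply Rmult_eq_reg_r with (Rpower (1 - x) n).
- rewrite Hh; field; apply Rgt_not_eq, exp_pos.
- apply Rgt_not_eq, exp_pos.
Qed.

(** * Euler's integral *)

Lemma CV_radius_incr_n (k : nat) (a : nat -> R) :
  CV_radius (PS_incr_n a k) = CV_radius a.
Proof.
induction k as [|k IH]; [reflexivity|].
change (CV_radius (PS_incr_1 (PS_incr_n a k)) = CV_radius a).
rewrite CV_radius_incr_1; exact IH.
Qed.

(** Turns the Pochhammer symbols with positive integer parameter, in the series and in the
    prefactor, into quotients of factorials. *)
Lemma poch_INR_S (m j : nat) :
  poch (INR (S m)) j = INR (fact (m + j)) / INR (fact m).
Proof.
assert (Hf := INR_fact_neq_0 m).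
induction j as [|j IH]; cbn [poch].
- rewrite Nat.add_0_r; field; exact Hf.
- rewrite IH, Nat.add_succ_r, fact_simpl, mult_INR, <- plus_INR.
  change (S m + j)%nat with (S (m + j)); field; exact Hf.
Qed.

(* Euler's integral in the variable [u = x t]. *)
Lemma is_RInt_hyp2F1 (m q : nat) (n x : R) : Rabs x < 1 ->
  is_RInt (fun u => (x - u) ^ q * (u ^ m * Rpower (1 - u) (- n))) 0 x
    (INR (fact q) * (x ^ (S q + m) *
      (INR (fact m) / INR (fact (S q + m)) *
       hyp2F1 (INR (S m)) n (INR (S (S q + m))) x))).
Proof.
intros Hx.
(* In this lemma [m] and [q] stand for m-1 and p-m-1 of the theorem. The shifted series [a]
   represents [u^m (1-u)^(-n)]. *)
set (a := PS_incr_n (binom_series n) m).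
assert (HI : is_RInt (fun u => (x - u) ^ q * PSeries a u) 0 x
  (INR (fact q) * PSeries (PS_Int_n (S q) a) x)).
{ apply is_RInt_repeated_PSeries; unfold a; rewrite CV_radius_incr_n.
  apply CV_radius_binom_series, Hx. }
unfold hyp2F1; rewrite <- PSeries_scal, <- PSeries_incr_n.
(* The power of [x] has been absorbed as an index shift, so it remains to compare coefficients. At
   index [S q + m + i] both sides are [(n)_i / i!] times [(m+i)! / (S q + m + i)!]. *)
rewrite (PSeries_ext _ (PS_Int_n (S q) a)).
- revert HI; apply is_RInt_ext.
  intros u Hu; unfold a.
  rewrite PSeries_incr_n, PSeries_binom_series; [reflexivity|].
  apply (Rbar_lt_Rabs_between x u 1 Hx); lra.
- intros j; rewrite PS_incr_n_simplify.
  destruct (Compare_dec.le_lt_dec (S q + m) j) as [Hj|Hj].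
  + replace j with (S q + (m + (j - (S q + m))))%nat at 2 by lia.
    set (i := (j - (S q + m))%nat).
    rewrite PS_Int_n_plus; unfold a; rewrite PS_incr_n_simplify.
    destruct (Compare_dec.le_lt_dec m (m + i)) as [_|H]; [|lia].
    replace (m + i - m)%nat with i by lia.
    change (INR (fact m) / INR (fact (S q + m)) *
      hyp2F1_coeff (INR (S m)) n (INR (S (S q + m))) i =
      binom_series n i * INR (fact (m + i)) / INR (fact (S q + (m + i)))).
    unfold binom_series, hyp2F1_coeff; rewrite !poch_INR_S, Nat.add_assoc.
    assert (H1 := INR_fact_neq_0 i); assert (H2 := INR_fact_neq_0 m).
    assert (H3 := INR_fact_neq_0 (S q + m)).
    assert (H4 := INR_fact_neq_0 (S q + m + i)).
    field; auto.
  (* Below the shift the right side vanishes too: for [j >= S q] because [a] starts at index [m],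
     for smaller [j] because all constants of integration are 0. *)
  + change (0 = PS_Int_n (S q) a j).
    destruct (Nat.le_gt_cases (S q) j) as [Hq|Hq].
    * replace j with (S q + (j - S q))%nat by lia.
      rewrite PS_Int_n_plus; unfold a; rewrite PS_incr_n_simplify.
      destruct (Compare_dec.le_lt_dec m (j - S q)) as [H|_]; [lia|].
      change zero with 0; unfold Rdiv; ring.
    * symmetry; apply PS_Int_n_lt, Hq.
Qed.

(** * Expansion into integrals of powers of [s] *)

Lemma is_RInt_sum_f_R0 (f : nat -> R -> R) (I : nat -> R) (a b : R) (N : nat) :
  (forall i, (i <= N)%nat -> is_RInt (f i) a b (I i)) ->
  is_RInt (fun s => sum_f_R0 (fun i => f i s) N) a b (sum_f_R0 I N).
Proof.
induction N as [|N IH]; intros H; simpl.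
- apply H; lia.
- apply (is_RInt_plus (V := R_NormedModule)); [apply IH; intros i Hi|]; apply H; lia.
Qed.

Lemma is_RInt_scal_l (c : R) (f : R -> R) (a b l : R) :
  is_RInt f a b l -> is_RInt (fun s => c * f s) a b (c * l).
Proof. exact (is_RInt_scal (V := R_NormedModule) f a b c l). Qed.

(** The antiderivative is [ln s] for [r = -1] and [s^(r+1)/(r+1)] otherwise. The end [c] may exceed
    1, as happens for [c = 1 - x] with negative [x]; the interval stays among the positive reals. *)
Lemma is_RInt_Rpower (c r : R) : 0 < c ->
  is_RInt (fun s => Rpower s r) c 1
    (if Req_EM_T r (-1) then - ln c
     else (1 - Rpower c (r + 1)) / (r + 1)).
Proof.
intros Hc.
assert (Hpos : forall s, Rmin c 1 <= s <= Rmax c 1 -> 0 < s).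
{ intros s [Hs _]; apply Rlt_le_trans with (2 := Hs), Rmin_glb_lt; lra. }
assert (Hcont : forall s, Rmin c 1 <= s <= Rmax c 1 ->
  continuous (fun s => Rpower s r) s).
{ intros s Hs; apply (ex_derive_continuous (V := R_NormedModule)).
  eexists; apply is_derive_Reals, derivable_pt_lim_power, Hpos, Hs. }
destruct (Req_EM_T r (-1)) as [->|Hr].
- replace (- ln c) with (minus (ln 1) (ln c)).
  2: { rewrite ln_1; unfold minus, plus, opp; simpl; ring. }
  apply (is_RInt_derive (V := R_CompleteNormedModule) ln); [|exact Hcont].
  intros s Hs; assert (Hs' := Hpos s Hs).
  change (-1) with (Ropp 1); rewrite (Rpower_Ropp s 1), Rpower_1 by exact Hs'.
  apply is_derive_Reals, derivable_pt_lim_ln, Hs'.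
- assert (Hr1 : r + 1 <> 0) by (intros E; apply Hr; lra).
  replace ((1 - Rpower c (r + 1)) / (r + 1)) with
    (minus (/ (r + 1) * Rpower 1 (r + 1)) (/ (r + 1) * Rpower c (r + 1))).
  2: { unfold Rpower at 1; rewrite ln_1, Rmult_0_r, exp_0.
       unfold minus, plus, opp; simpl; field; exact Hr1. }
  apply (is_RInt_derive (V := R_CompleteNormedModule)
    (fun s => / (r + 1) * Rpower s (r + 1))); [|exact Hcont].
  intros s Hs.
  replace (Rpower s r) with (/ (r + 1) * ((r + 1) * Rpower s (r + 1 - 1))).
  2: { replace (r + 1 - 1) with r by ring; field; exact Hr1. }
  apply is_derive_scal, is_derive_Reals, derivable_pt_lim_power, Hpos, Hs.
Qed.

Lemma pow_one_minus (s : R) (N : nat) :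
  (1 - s) ^ N = sum_f_R0 (fun i => Binomial.C N i * (-1) ^ i * s ^ i) N.
Proof.
replace (1 - s) with (- s + 1) by ring.
rewrite binomial; apply sum_eq; intros i _.
replace (- s) with (-1 * s) by ring.
rewrite Rpow_mult_distr, pow1; ring.
Qed.

Lemma pow_minus_binomial (x v : R) (N : nat) :
  (x - v) ^ N =
  sum_f_R0 (fun j => Binomial.C N j * (-1) ^ j * x ^ (N - j) * v ^ j) N.
Proof.
replace (x - v) with (- v + x) by ring.
rewrite binomial; apply sum_eq; intros i _.
replace (- v) with (-1 * v) by ring.
rewrite Rpow_mult_distr; ring.
Qed.

(** Three binomial expansions: index [k] comes from [(1-s)^m], [j] from [(x-(1-s))^q] in powers of
    [1-s], and [i] from [(1-s)^j]. Positivity of [s] lets [s^i], [s^k] and [s^(-n)] merge into one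
    real power. *)
Lemma hyp2F1_kernel_expansion (m q : nat) (n x s : R) : 0 < s ->
  sum_f_R0 (fun k =>
    (-1) ^ k * Binomial.C m k *
    sum_f_R0 (fun j =>
      Binomial.C q j * (-1) ^ j * x ^ (q - j) *
      sum_f_R0 (fun i =>
        Binomial.C j i * (-1) ^ i * Rpower s (INR (i + k) - n)) j) q) m =
  (x - (1 - s)) ^ q * ((1 - s) ^ m * Rpower s (- n)).
Proof.
intros Hs.
rewrite (pow_one_minus s m), (Rmult_comm (sum_f_R0 _ _)), <- Rmult_assoc, scal_sum.
apply sum_eq; intros k _.
rewrite (pow_minus_binomial x (1 - s) q).
match goal with |- ?c * sum_f_R0 _ _ = _ * (?S * _) =>
  transitivity (c * (s ^ k * Rpower s (- n) * S)); [f_equal|ring] end.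
rewrite scal_sum; apply sum_eq; intros j _.
match goal with |- ?c * _ = _ * _ * ?w =>
  transitivity (c * (w * (1 - s) ^ j)); [f_equal|ring] end.
rewrite (pow_one_minus s j), scal_sum; apply sum_eq; intros i _.
unfold Rminus; rewrite Rpower_plus, Rpower_pow, pow_add by exact Hs; ring.
Qed.

(** Both sides equal the integral of the kernel over [s] from [1 - x] to 1: the left by the
    expansion and linearity, the right by substituting [u = 1 - s] in Euler's integral. *)
Lemma RInt_sum_hyp2F1 (m q : nat) (n x : R) : Rabs x < 1 ->
  sum_f_R0 (fun k =>
    (-1) ^ k * Binomial.C m k *
    sum_f_R0 (fun j =>
      Binomial.C q j * (-1) ^ j * x ^ (q - j) *
      sum_f_R0 (fun i =>
        Binomial.C j i * (-1) ^ i *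
        RInt (fun s => Rpower s (INR (i + k) - n)) (1 - x) 1) j) q) m =
  INR (fact q) * (x ^ (S q + m) *
    (INR (fact m) / INR (fact (S q + m)) *
     hyp2F1 (INR (S m)) n (INR (S (S q + m))) x)).
Proof.
intros Hx.
assert (Hx1 : 0 < 1 - x) by (apply Rabs_def2 in Hx; lra).
assert (HJ := is_RInt_hyp2F1 m q n x Hx).
(* The substitution reverses the orientation, so Euler's integral is first taken from [x] to 0; this
   sign cancels the one from [du = -ds]. *)
apply (is_RInt_swap (V := R_NormedModule)) in HJ.
match type of HJ with is_RInt _ _ _ (opp ?l) => set (L := l) in * end.
rewrite <- (is_RInt_unique (V := R_CompleteNormedModule)
  (fun s => (x - (1 - s)) ^ q * ((1 - s) ^ m * Rpower s (- n))) (1 - x) 1 L).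
- symmetry; apply (is_RInt_unique (V := R_CompleteNormedModule)).
  eapply (is_RInt_ext (V := R_NormedModule)).
  { intros s [Hs _]; apply hyp2F1_kernel_expansion.
    apply Rlt_trans with (2 := Hs), Rmin_glb_lt; lra. }
  apply is_RInt_sum_f_R0; intros k _; apply is_RInt_scal_l.
  apply is_RInt_sum_f_R0; intros j _; apply is_RInt_scal_l.
  apply is_RInt_sum_f_R0; intros i _; apply is_RInt_scal_l.
  apply (RInt_correct (V := R_CompleteNormedModule)).
  eexists; apply is_RInt_Rpower, Hx1.
- apply (is_RInt_ext (V := R_NormedModule)) with (fun s =>
    opp (scal (-1) ((x - (-1 * s + 1)) ^ q *
      ((-1 * s + 1) ^ m * Rpower (1 - (-1 * s + 1)) (- n))))).
  { intros s _; replace (-1 * s + 1) with (1 - s) by ring.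
    replace (1 - (1 - s)) with s by ring.
    unfold opp, scal; simpl; unfold mult; simpl; ring. }
  replace L with (opp (opp L)) by (apply opp_opp).
  apply (is_RInt_opp (V := R_NormedModule)), (is_RInt_comp_lin (V := R_NormedModule)
    (fun u => (x - u) ^ q * (u ^ m * Rpower (1 - u) (- n)))).
  replace (-1 * (1 - x) + 1) with x by ring.
  replace (-1 * 1 + 1) with 0 by ring.
  exact HJ.
Qed.

(** * Closure properties of elementary functions *)

Lemma elementary_ext (f g : R -> R) :
  (forall x, 0 < Rabs x < 1 -> f x = g x) -> elementary g -> elementary f.
Proof.
intros H [e He]; exists e; intros x Hx.
rewrite H by exact Hx; apply He, Hx.
Qed.

Lemma elementary_const (c : R) : elementary (fun _ => c).
Proof. exists (EConst c); simpl; auto. Qed.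

Lemma elementary_id : elementary (fun x => x).
Proof. exists EVar; simpl; auto. Qed.

Lemma elementary_plus (f g : R -> R) :
  elementary f -> elementary g -> elementary (fun x => f x + g x).
Proof.
intros [e He] [e' He']; exists (EAdd e e'); intros x Hx; simpl.
destruct (He x Hx) as [? <-], (He' x Hx) as [? <-]; auto.
Qed.

Lemma elementary_minus (f g : R -> R) :
  elementary f -> elementary g -> elementary (fun x => f x - g x).
Proof.
intros [e He] [e' He']; exists (ESub e e'); intros x Hx; simpl.
destruct (He x Hx) as [? <-], (He' x Hx) as [? <-]; auto.
Qed.

Lemma elementary_mult (f g : R -> R) :
  elementary f -> elementary g -> elementary (fun x => f x * g x).
Proof.
intros [e He] [e' He']; exists (EMul e e'); intros x Hx; simpl.
destruct (He x Hx) as [? <-], (He' x Hx) as [? <-]; auto.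
Qed.

Lemma elementary_div (f g : R -> R) :
  (forall x, 0 < Rabs x < 1 -> g x <> 0) ->
  elementary f -> elementary g -> elementary (fun x => f x / g x).
Proof.
intros Hg [e He] [e' He']; exists (EDiv e e'); intros x Hx; simpl.
specialize (Hg x Hx).
destruct (He x Hx) as [? <-], (He' x Hx) as [? <-]; auto.
Qed.

Lemma elementary_Rpower (f : R -> R) (r : R) :
  (forall x, 0 < Rabs x < 1 -> 0 < f x) ->
  elementary f -> elementary (fun x => Rpower (f x) r).
Proof.
intros Hf [e He]; exists (EPow e r); intros x Hx; simpl.
specialize (Hf x Hx); destruct (He x Hx) as [? <-]; auto.
Qed.

Lemma elementary_ln (f : R -> R) :
  (forall x, 0 < Rabs x < 1 -> 0 < f x) ->
  elementary f -> elementary (fun x => ln (f x)).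
Proof.
intros Hf [e He]; exists (ELn e); intros x Hx; simpl.
specialize (Hf x Hx); destruct (He x Hx) as [? <-]; auto.
Qed.

(** Built by repeated multiplication, since [EPow] demands a positive base and [f x] may be
    negative. *)
Lemma elementary_pow (f : R -> R) (k : nat) :
  elementary f -> elementary (fun x => f x ^ k).
Proof.
intros Hf; induction k as [|k IH]; simpl;
  [apply elementary_const | apply elementary_mult; assumption].
Qed.

Lemma elementary_sum (f : nat -> R -> R) (N : nat) :
  (forall i, elementary (f i)) ->
  elementary (fun x => sum_f_R0 (fun i => f i x) N).
Proof.
intros Hf; induction N as [|N IH]; simpl;
  [apply Hf | apply elementary_plus; auto].
Qed.

Lemma elementary_RInt_Rpower (r : R) :
  elementary (fun x => RInt (fun s => Rpower s r) (1 - x) 1).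
Proof.
assert (Hpos : forall x, 0 < Rabs x < 1 -> 0 < 1 - x)
  by (intros x [_ Hx]; apply Rabs_def2 in Hx; lra).
assert (He : elementary (fun x => 1 - x))
  by (apply elementary_minus; [apply elementary_const | apply elementary_id]).
eapply elementary_ext.
{ intros x Hx; apply (is_RInt_unique (V := R_CompleteNormedModule)).
  apply is_RInt_Rpower, Hpos, Hx. }
(* The case distinction concerns [r] alone, so a single expression serves all [x]. *)
destruct (Req_EM_T r (-1)) as [_|Hr].
- apply elementary_ext with (fun x => 0 - ln (1 - x)); [intros; ring|].
  apply elementary_minus; [apply elementary_const | apply elementary_ln; assumption].
- apply elementary_div; [intros; lra | | apply elementary_const].
  apply elementary_minus; [apply elementary_const|].
  apply elementary_Rpower; assumption.
Qed.

(** * The triple-sum formula and elementarity *)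

Theorem theorem2p1 (m p : nat) (n : R) (hm : (1 <= m)%nat) (hp : (m + 1 <= p)%nat) :
  (forall x : R, 0 < Rabs x < 1 ->
    hyp2F1 (INR m) n (INR p) x =
      poch (INR m) (p - m) * powerRZ x (1 - Z.of_nat p) / INR (fact (p - m - 1)) *
      sum_f_R0 (fun k : nat =>
        (-1) ^ k * Binomial.C (m - 1) k *
        sum_f_R0 (fun j : nat =>
          Binomial.C (p - m - 1) j * (-1) ^ j * x ^ (p - m - 1 - j) *
          sum_f_R0 (fun i : nat =>
            Binomial.C j i * (-1) ^ i *
            RInt (fun s : R => Rpower s (INR (i + k) - n)) (1 - x) 1)
          j)
        (p - m - 1))
      (m - 1))
  /\ elementary (fun x : R => hyp2F1 (INR m) n (INR p) x).
Proof.
(* As a reciprocal of a natural power, [x^(1-p)] is elementary for negative [x] as well. *)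
assert (Hpow : forall x, powerRZ x (1 - Z.of_nat p) = 1 / x ^ (p - 1)).
{ intros x; replace (1 - Z.of_nat p)%Z with (- Z.of_nat (p - 1))%Z by lia.
  rewrite powerRZ_neg', <- pow_powerRZ; unfold Rdiv; ring. }
assert (Hne : forall x, 0 < Rabs x < 1 -> x ^ (p - 1) <> 0).
{ intros x [Hx _]; apply pow_nonzero; intros ->; rewrite Rabs_R0 in Hx; lra. }
match goal with |- ?F /\ _ => assert (formula : F) end.
{ intros x Hx; rewrite Hpow; specialize (Hne x Hx).
  assert (exists m' q, m = S m' /\ p = S (S q + m')) as (m' & q & -> & ->).
  { exists (m - 1)%nat, (p - m - 1)%nat; lia. }
  replace (S m' - 1)%nat with m' by lia.
  replace (S (S q + m') - S m' - 1)%nat with q by lia.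
  replace (S (S q + m') - 1)%nat with (S q + m')%nat in * by lia.
  (* The prefactor is the inverse of the constant in Euler's integral: [(m)_{p-m} = (p-1)!/(m-1)!],
     and [x^(p-1)] and [(p-m-1)!] cancel. *)
  rewrite RInt_sum_hyp2F1, poch_INR_S by apply Hx.
  replace (m' + (S (S q + m') - S m'))%nat with (S q + m')%nat by lia.
  assert (H1 := INR_fact_neq_0 q); assert (H2 := INR_fact_neq_0 m').
  assert (H3 := INR_fact_neq_0 (S q + m')).
  field; auto. }
split; [exact formula|].
eapply elementary_ext; [exact formula|].
apply elementary_mult.
- apply elementary_div; [intros; apply INR_fact_neq_0 | | apply elementary_const].
  apply elementary_mult; [apply elementary_const|].
  apply elementary_ext with (fun x => 1 / x ^ (p - 1)); [intros; apply Hpow|].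
  apply elementary_div;
    [exact Hne | apply elementary_const | apply elementary_pow, elementary_id].
- apply elementary_sum; intros k.
  apply elementary_mult; [apply elementary_const|].
  apply elementary_sum; intros j.
  apply elementary_mult;
    [apply elementary_mult; [apply elementary_const | apply elementary_pow, elementary_id]|].
  apply elementary_sum; intros i.
  apply elementary_mult; [apply elementary_const | apply elementary_RInt_Rpower].
Qed.
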